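(* Let $K$ be a number field and let $\mathfrak{A}$ be a non-zero principal ideal of $\mathcal{O}_K$ having a strictly large generator $\pi$. Let $\mathcal{R}$ be any complete set of representatives of $\mathcal{O}_K/\mathfrak{A}$ containing $0$. Then the special type $(K,\pi,\mathcal{R})$ is bounded.
   Context: An element $x\in\mathcal{O}_K$ is strictly large if $|\sigma(x)|>1$ for every embedding $\sigma:K\to\mathbb{C}$. Let $\mathcal{M}_K^0$ be a set of representatives for the non-Archimedean places of $K$; for $v\in\mathcal{M}_K^0$ let $K_v$ be the completion of $K$ at $v$, $\mathcal{O}_v$ its valuation ring, and $|\cdot|_v$ the absolute value extending the $p$-adic one, where $v\mid p$. Let $S_0=\{v\in\mathcal{M}_K^0: v\mid\mathfrak{A}\}$, $\widetilde K=\prod_{v\mid\mathfrak{A}}K_v$ (with $K$ diagonally embedded), and $\widetilde{\mathcal{O}}=\prod_{v\mid\mathfrak{A}}\mathcal{O}_v$. An $\mathfrak{A}$-adic floor function for $K$ is a function $s:\widetilde K\to K$ such that (a) $\alpha-s(\alpha)\in\mathfrak{A}\widetilde{\mathcal{O}}$ for every $\alpha\in\widetilde K$; (b) $|s(\alpha)|_v\le1$ for every $\alpha\in\widetilde K$ and every $v\in\mathcal{M}_K^0\setminus S_0$; (c) $s(0)=0$; (d) $s(\alpha)=s(\beta)$ if $\alpha-\beta\in\mathfrak{A}\widetilde{\mathcal{O}}$. A type is a triple $\tau=(K,\mathfrak{A},s)$ with $s$ an $\mathfrak{A}$-adic floor function. Special types: if $\mathfrak{A}=\pi\mathcal{O}_K$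 and $\mathcal{R}$ is a complete set of representatives of $\mathcal{O}_K/\mathfrak{A}$ containing $0$, every $\alpha\in\widetilde K$ can be written uniquely as a Laurent series $\alpha=\sum_{j=-n}^\infty c_j\pi^j$ with all $c_j\in\mathcal{R}$ (convergent in $\widetilde K$), and $s(\alpha)=\sum_{j=-n}^0 c_j\pi^j\in K$ defines an $\mathfrak{A}$-adic floor function; the resulting type is denoted $(K,\pi,\mathcal{R})$ and called a special type. A type $(K,\mathfrak{A},s)$ is bounded if there is a real number $C>0$ such that $|\sigma(s(\alpha))|<C$ for every $\alpha\in K$ and every Archimedean embedding $\sigma:K\to\mathbb{C}$. *)

(* Defs.v *)
(* MathComp / MathComp-Analysis *)
From HB Require Import structures.
From mathcomp Require Import all_boot all_order all_algebra all_field.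
From mathcomp Require Import all_classical all_reals all_analysis.
From mathcomp.real_closed Require Import complex.

Set Implicit Arguments.
Unset Strict Implicit.
Unset Printing Implicit Defensive.

Import Order.TTheory GRing.Theory Num.Theory.
Import numFieldNormedType.Exports.

Local Open Scope classical_set_scope.
Local Open Scope ring_scope.

(* Number fields are the finite extensions [K : fieldExtType rat]; the real
   numbers are an arbitrary [R : realType] and the complex numbers [R[i]].    *)

Definition ring_of_integers (K : fieldExtType rat) : set K :=
  [set x | integralOver (intr : int -> K) x].
Arguments ring_of_integers K : clear implicits.

(* Embeddings are the ring morphisms from K to R[i]; the norm of R[i] takes
   values in R[i], on the real axis.                                          *)
Definition strictly_large (R : realType) (K : fieldExtType rat) (x : K) : Prop :=
  forall sigma : {rmorphism K -> R[i]}, 1 < `|sigma x|.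

Definition is_ideal (K : fieldExtType rat) (A : set K) : Prop :=
  [/\ A `<=` ring_of_integers K, A 0,
      (forall x y, A x -> A y -> A (x + y)) &
      (forall a x, ring_of_integers K a -> A x -> A (a * x))].

Definition principal_ideal (K : fieldExtType rat) (pi : K) : set K :=
  [set pi * x | x in ring_of_integers K].

Definition complete_representatives (K : fieldExtType rat) (A Reps : set K) :
    Prop :=
  Reps `<=` ring_of_integers K /\
  (forall x, ring_of_integers K x -> exists! r, Reps r /\ A (x - r)).

Definition nonarch_abs (R : realType) (F : fieldType) (N : F -> R) : Prop :=
  [/\ (forall x, 0 <= N x), (forall x, N x = 0 <-> x = 0),
      (forall x y, N (x * y) = N x * N y) &
      (forall x y, N (x + y) <= Num.max (N x) (N y))].

Definition padic_abs (R : realType) (p : nat) (q : rat) : R :=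
  if q == 0 then 0
  else p%:R ^ ((logn p `|denq q|%N)%:Z - (logn p `|numq q|%N)%:Z).

(* Each non-Archimedean place contains exactly one absolute value extending
   some p-adic one, so these normalized absolute values form a set of
   representatives of the non-Archimedean places.                             *)
Record finite_place (R : realType) (K : fieldExtType rat) := FinitePlace {
  place_abs :> K -> R;
  place_abs_nonarch : nonarch_abs place_abs;
  place_abs_padic :
    exists2 p, prime p & forall q : rat, place_abs q%:A = padic_abs R p q }.

(* v divides A iff A lies in the prime ideal {x in O_K | `|x|_v < 1} of v. *)
Definition place_dvd (R : realType) (K : fieldExtType rat)
    (v : finite_place R K) (A : set K) : Prop :=
  forall a, A a -> v a < 1.

(* A completion of K at v, which is unique up to a unique isometric
   isomorphism over K.                                                        *)
Record completion (R : realType) (K : fieldExtType rat)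
    (v : finite_place R K) := Completion {
  completion_field :> fieldType;
  completion_emb : {rmorphism K -> completion_field};
  completion_abs : completion_field -> R;
  completion_abs_nonarch : nonarch_abs completion_abs;
  completion_abs_emb : forall x, completion_abs (completion_emb x) = v x;
  completion_dense : forall (y : completion_field) (e : R), 0 < e ->
    exists x : K, completion_abs (y - completion_emb x) < e;
  completion_complete : forall u : nat -> completion_field,
    (forall e : R, 0 < e -> exists N : nat, forall m n : nat,
       (N <= m)%N -> (N <= n)%N -> completion_abs (u m - u n) < e) ->
    exists l, (fun n => completion_abs (u n - l)) @ \oo --> (0 : R) }.

Section Types.
Variables (R : realType) (K : fieldExtType rat).
Variable Kv : forall v : finite_place R K, completion v.

(* The product of the K_v over the places v dividing A. *)
Definition tildeK (A : set K) : Type :=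
  forall v : {v : finite_place R K | place_dvd v A}, Kv (sval v).

Definition diag (A : set K) (x : K) : tildeK A :=
  fun v => completion_emb (Kv (sval v)) x.
Arguments diag A x v : clear implicits.

Definition tildeO (A : set K) : set (tildeK A) :=
  [set alpha : tildeK A | forall v, completion_abs (alpha v) <= 1].
Arguments tildeO A : clear implicits.

(* The ideal of tildeO A generated by the image of A. *)
Definition A_tildeO (A : set K) : set (tildeK A) :=
  [set alpha : tildeK A | exists (n : nat) (a : 'I_n -> K) (b : 'I_n -> tildeK A),
    [/\ (forall i, A (a i)), (forall i, tildeO A (b i)) &
        (forall v, alpha v = \sum_(i < n) diag A (a i) v * b i v)]].
Arguments A_tildeO A : clear implicits.

Definition is_floor_function (A : set K) (s : tildeK A -> K) : Prop :=
  [/\ (forall alpha : tildeK A, A_tildeO A (fun v => alpha v - diag A (s alpha) v)),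
      (forall (alpha : tildeK A) (v : finite_place R K),
         ~ place_dvd v A -> v (s alpha) <= 1),
      s (fun v => 0) = 0 &
      (forall alpha beta : tildeK A,
         A_tildeO A (fun v => alpha v - beta v) -> s alpha = s beta)].

(* The field K being fixed, a triple (K, A, s) is the pair of A and s; it is
   a type when it satisfies is_type.                                          *)
Record type_data := TypeData {
  type_ideal : set K;
  type_floor : tildeK type_ideal -> K }.

Definition is_type (tau : type_data) : Prop :=
  [/\ is_ideal (type_ideal tau), type_ideal tau <> [set 0] &
      is_floor_function (@type_floor tau)].

Definition bounded_type (tau : type_data) : Prop :=
  exists2 C : R, 0 < C &
    forall (alpha : K) (sigma : {rmorphism K -> R[i]}),
      `|sigma (type_floor (diag (type_ideal tau) alpha))| < C%:C%C.

(* \sum_(-n <= j <= N) c_j pi^j *)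
Definition laurent_sum (pi : K) (c : int -> K) (n N : nat) : K :=
  \sum_(i < n + N.+1) c (i%:Z - n%:Z) * pi ^ (i%:Z - n%:Z).

(* alpha = \sum_(j >= -n) c_j pi^j, convergent in tildeK, with digits in Reps;
   only the values of c at indices j >= -n matter.                            *)
Definition laurent_expansion (pi : K) (Reps A : set K) (alpha : tildeK A)
    (n : nat) (c : int -> K) : Prop :=
  (forall j : int, - n%:Z <= j -> Reps (c j)) /\
  (forall v, (fun N : nat =>
       completion_abs (diag A (laurent_sum pi c n N) v - alpha v))
     @ \oo --> (0 : R)).

(* When Reps is a complete set of representatives of O_K / A containing 0 and
   A = pi O_K <> 0, every alpha has an expansion, unique up to leading zeros, so
   that the set below is a singleton. The default value 0 of xget is then
   irrelevant.                                                                *)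
Definition special_floor (pi : K) (Reps A : set K) (alpha : tildeK A) : K :=
  xget 0 [set x | exists (n : nat) (c : int -> K),
    laurent_expansion pi Reps alpha n c /\ x = laurent_sum pi c n 0].

Definition special_type (pi : K) (Reps : set K) : type_data :=
  TypeData (@special_floor pi Reps (principal_ideal pi)).

End Types.

(* Main.v *)
(* A digit expansion truncated at exponent 0 is a finite sum of c_j pi^j with
   j <= 0, so under an embedding sigma it is dominated by a geometric series of
   ratio 1 / |sigma pi| < 1, uniformly in the length of the expansion. It remains
   to bound the digits and the ratios uniformly in sigma: an element of K has
   finitely many conjugates, and there are finitely many digits. For the latter,
   pi divides a positive integer N, and among sufficiently many elements of K two
   differ by N times an integral combination of these elements.               *)
Require Import Defs.
From HB Require Import structures.
From mathcomp Require Import all_boot all_order all_algebra all_field.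
From mathcomp Require Import all_classical all_reals all_analysis.
From mathcomp.real_closed Require Import complex.

Set Implicit Arguments.
Unset Strict Implicit.
Unset Printing Implicit Defensive.

Import Order.TTheory GRing.Theory Num.Theory.
Import numFieldNormedType.Exports.
Import passmx.

Local Open Scope classical_set_scope.
Local Open Scope ring_scope.

(** * Congruences modulo [N] in a rational vector space *)

Lemma common_denominator m n (X : 'M[rat]_(m, n)) :
  exists2 d : int, d != 0 &
    exists M : 'M[int]_(m, n), d%:~R *: X = map_mx intr M.
Proof.
exists (\prod_i \prod_j denq (X i j)).
  by apply/prodf_neq0 => i _; apply/prodf_neq0 => j _; rewrite denq_neq0.
set d := \prod_i _.
exists (\matrix_(i, j) numq (d%:~R * X i j)); apply/matrixP => i j.
rewrite !mxE; have dvd_d : (denq (X i j) %| d)%Z.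
  by rewrite /d (bigD1 i) //= (bigD1 j) //= -mulrA dvdz_mulr.
have /dvdzP [q ->] := dvd_d.
by rewrite intrM -mulrA [_%:~R * X i j]mulrC -numqE -intrM numq_int.
Qed.

(* By the Smith normal form, the rows of [M] are integral combinations of [n]
   vectors that are themselves integral combinations of the rows of [M]; modulo
   [N] the coefficients take at most [N ^ n] values.                          *)
Lemma congruent_rows (m n N : nat) (M : 'M[int]_(m, n)) :
  (0 < N)%N -> (n <= m)%N -> (N ^ n < m)%N ->
  exists i j : 'I_m, i != j /\
    exists w : 'rV[int]_m, row i M - row j M = N%:Z *: (w *m M).
Proof.
move=> N_gt0 le_nm lt_m.
have [L uL [S _ [d _ defM]]] := int_Smith_normal_form M.
(* The rectangular diagonal factor of the Smith form is split as [P] times a square diagonal matrix;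
   the rows of [B] are the [n] vectors. *)
pose P : 'M[int]_(m, n) := pid_mx n.
pose B : 'M[int]_n := diag_mx (\row_j d`_j) *m S.
have {}defM : M = L *m P *m B.
  rewrite defM !mulmxA; congr (_ *m S); rewrite -mulmxA; congr (_ *m _).
  apply/matrixP => i j; rewrite mul_mx_diag !mxE.
  case: eqP => [->|_]; last by rewrite mul0r.
  by rewrite ltn_ord mul1r.
have PTP : P^T *m P = 1%:M.
  by rewrite tr_pid_mx mul_pid_mx !minnn (minn_idPr le_nm) pid_mx_1.
pose Q := L *m P.
case: N N_gt0 lt_m => // N _ lt_m.
pose f (i : 'I_m) : {ffun 'I_n -> 'I_N.+1} :=
  [ffun k => inord `|(Q i k %% N.+1%:Z)%Z|%N].
have [i [j [neq_ij eq_f]]] : exists i j, i != j /\ f i = f j.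
  apply: contrapT => no_coll.
  have /leq_card : injective f.
    move=> i j eq_f; apply: contrapT => neq_ij.
    by apply: no_coll; exists i, j; split=> //; apply/eqP.
  by rewrite card_ffun !card_ord leqNgt lt_m.
exists i, j; split=> //.
pose t : 'rV[int]_n := \row_k ((Q i k - Q j k) %/ N.+1%:Z)%Z.
(* As [P^T] is a left inverse of [P], [B] equals [P^T *m invmx L *m M], which turns [t *m B] into a
   combination of the rows of [M]. *)
exists (t *m P^T *m invmx L).
have -> : t *m P^T *m invmx L *m M = t *m B.
  by rewrite defM !mulmxA mulmxKV // -(mulmxA t) PTP mulmx1.
rewrite defM -/Q !(row_mul _ Q) -mulmxBl scalemxAl; congr (_ *m B).
apply/rowP => k.
suff dvd_k : (N.+1%:Z %| Q i k - Q j k)%Z.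
  rewrite [RHS]mxE [t _ _]mxE mulrC divzK //.
  by rewrite !mxE.
have /ffunP/(_ k) := eq_f; rewrite !ffunE => /(congr1 val) /=.
have bound z : (`|(z %% N.+1%:Z)%Z|%N < N.+1)%N.
  by rewrite -ltz_nat gez0_abs ?modz_ge0 // ltz_pmod.
rewrite !inordK // => eq_abs; rewrite -eqz_mod_dvd; apply/eqP.
by rewrite -[LHS]gez0_abs ?modz_ge0 // eq_abs gez0_abs // modz_ge0.
Qed.

(** Coordinates multiplied by a common denominator [d] are integer rows; the congruence found there
    is linear, so [d] cancels. *)
Lemma congruent_vectors (V : vectType rat) (m N : nat) (x : 'I_m -> V) :
  (0 < N)%N -> (\dim {:V} <= m)%N -> (N ^ \dim {:V} < m)%N ->
  exists i j : 'I_m, i != j /\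
    exists w : 'I_m -> int, x i - x j = (\sum_k x k *~ w k) *+ N.
Proof.
move=> N_gt0 le_m lt_m.
pose X := \matrix_i rVof (vbasis {:V}) (x i).
have [d d_neq0 [M defM]] := common_denominator X.
have [i [j [neq_ij [w eq_w]]]] := congruent_rows M N_gt0 le_m lt_m.
exists i, j; split=> //; exists (w 0).
have rK : injective (rVof (vbasis {:V})) := can_inj (rVofK (vbasisP _)).
apply: rK; apply: (scalerI (_ : d%:~R != 0 :> rat)); first by rewrite intr_eq0.
have scale_rV k : d%:~R *: rVof (vbasis {:V}) (x k) = map_mx intr (row k M).
  by rewrite map_row -defM linearZ /= [row k X]rowK.
rewrite linearB linearMn linear_sum scalerBr -scaler_nat scalerA mulrC -scalerA.
rewrite scaler_sumr !scale_rV -map_mxB eq_w map_mxZ /=; congr (_ *: _).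
rewrite map_mxM mulmx_sum_row; apply: eq_bigr => k _; rewrite -map_row -scale_rV.
by rewrite -[x k *~ _]scaler_int [in RHS]linearZ /= !scalerA mxE mulrC.
Qed.


(** * Algebraic integers and finiteness of the digit set *)

Lemma ring_of_integers0 (K : fieldExtType rat) : ring_of_integers K 0.
Proof. exact: (mxpoly.integral0 (intr : {rmorphism int -> K})). Qed.

Lemma ring_of_integers_mulrz (K : fieldExtType rat) (x : K) (n : int) :
  ring_of_integers K x -> ring_of_integers K (x *~ n).
Proof.
move=> x_int; rewrite -mulrzr; apply: integral_mul => //.
exact: (integral_id (intr : {rmorphism int -> K})).
Qed.

(** Dividing a monic equation of [x] by the largest possible power of ['X] leaves a non-zero
    constant term [c]; then [q(x) * x + c = 0] shows that [x] divides [c], with a cofactor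
    polynomial in [x]. *)
Lemma integral_dvd_nat (K : fieldExtType rat) (x : K) :
  ring_of_integers K x -> x != 0 ->
  exists2 N : nat, (0 < N)%N &
    exists2 y, ring_of_integers K y & N%:R = x * y.
Proof.
move=> x_int x_neq0; have [p p_monic p_root] := x_int.
have p_neq0 : p != 0 by apply: monic_neq0.
have {p_root p_monic p_neq0} [q q0 q_root] :
    exists2 q : {poly int}, q`_0 != 0 & root (map_poly intr q) x.
  have [k [q]] := multiplicity_XsubC p 0.
  rewrite p_neq0 /= subr0 /root horner_coef0 => q0 defp.
  exists q => //; move: p_root.
  rewrite defp rmorphM rmorphXn /= map_polyX /root hornerM hornerXn.
  by rewrite mulf_eq0 expf_eq0 (negPf x_neq0) andbF orbF.
(* The induction only serves to split off the constant term; its hypothesis is dropped. *)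
elim/poly_ind: q q0 q_root => [|q c _]; first by rewrite coef0 eqxx.
rewrite coefD coefMX coefC add0r /root => c_neq0.
rewrite rmorphD rmorphM /= map_polyX map_polyC /= hornerD hornerMX hornerC.
rewrite addrC addr_eq0 => /eqP def_c.
exists `|c|%N; first by rewrite absz_gt0.
exists ((map_poly intr q).[x] *~ - sgz c).
  apply: ring_of_integers_mulrz; apply: integral_horner => //.
  apply/integral_poly => i; rewrite coef_map.
  exact: (integral_id (intr : {rmorphism int -> K})).
rewrite pmulrn abszEsg intrM def_c -[X in x * X]mulrzr intrN !mulrN; congr (- _).
by rewrite mulrCA mulrA mulrC.
Qed.


Lemma complete_representatives_finite (K : fieldExtType rat) (x : K)
    (Reps : set K) :
  ring_of_integers K x -> x != 0 ->
  complete_representatives (principal_ideal x) Reps -> finite_set Reps.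
Proof.
move=> x_int x_neq0 [Reps_int Reps_uniq]; apply: contrapT => Reps_inf.
have [N N_gt0 [y y_int defN]] := integral_dvd_nat x_int x_neq0.
(* Large enough for both size conditions of [congruent_vectors]. *)
pose m := (N ^ \dim {:K} + \dim {:K}).+1.
have [B B_Reps le_m] := infinite_set_fset m Reps_inf.
pose r (i : 'I_m) : K := nth 0 (finmap.enum_fset B) i.
have rP i : Reps (r i).
  by apply: B_Reps; apply: mem_nth; apply: leq_trans le_m.
have [||i [j [neq_ij [w eq_w]]]] := congruent_vectors r N_gt0.
- by apply: leqW; apply: leq_addl.
- by rewrite /m ltnS leq_addr.
(* Both [r i] and [r j] represent the class of [r i], so uniqueness identifies them, although they
   sit at distinct positions of a duplicate-free list. *)
have [s [_ s_uniq]] := Reps_uniq _ (Reps_int _ (rP i)).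
have eq_s : r i = r j.
  transitivity s; [apply/esym|]; apply: s_uniq; split; [exact: rP| |exact: rP|].
    by exists 0; [exact: ring_of_integers0 | rewrite mulr0 subrr].
  exists (y * \sum_k r k *~ w k); last by rewrite eq_w -mulr_natl defN mulrA.
  apply: integral_mul; first exact: y_int.
  elim/big_rec: _ => [|k z _ z_int]; first exact: ring_of_integers0.
  apply: integral_add z_int; apply: ring_of_integers_mulrz.
  exact: Reps_int (rP k).
have lt_size (k : 'I_m) : (k < size (finmap.enum_fset B))%N.
  exact: leq_trans (ltn_ord k) le_m.
move/eqP: neq_ij; apply; apply/val_inj/eqP.
rewrite -(nth_uniq 0 (lt_size i) (lt_size j) (finmap.fset_uniq B)).
by rewrite -/(r i) eq_s.
Qed.

(** * Conjugates and Archimedean estimates *)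

Lemma conjugates_finite (F : closedFieldType) (K : fieldExtType rat) (x : K) :
  exists s : seq F, forall sigma : {rmorphism K -> F}, sigma x \in s.
Proof.
have /polyOver1P [p def_p] := minPolyOver 1%AS x.
have p_neq0 : map_poly (in_alg K) p != 0.
  by rewrite -def_p; apply: monic_neq0; apply: monic_minPoly.
have p_root : root (map_poly (in_alg K) p) x by rewrite -def_p root_minPoly.
have [s def_s] := closed_field_poly_normal (map_poly (ratr : rat -> F) p).
exists s => sigma; rewrite -root_prod_XsubC.
(* All embeddings agree on the rationals, so the polynomial that kills [sigma x] is the same for
   every [sigma]. *)
have eq_ratr : sigma \o in_alg K =1 ratr by apply: fmorph_eq_rat.
have def_ratr : map_poly ratr p = map_poly sigma (map_poly (in_alg K) p).
  by rewrite -(eq_map_poly eq_ratr) map_poly_comp.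
have : root (map_poly ratr p) (sigma x) by rewrite def_ratr fmorph_root.
by rewrite def_s rootZ // lead_coef_eq0 def_ratr map_poly_eq0.
Qed.


(** The function [f] allows one statement to bound both the digits and the sums of the geometric
    series attached to the conjugates of [pi]. *)
Lemma conjugates_bounded (F : numClosedFieldType) (K : fieldExtType rat)
    (f : F -> F) (x : K) :
  exists2 B : F, 0 <= B &
    forall sigma : {rmorphism K -> F}, `|f (sigma x)| <= B.
Proof.
have [s sP] := conjugates_finite F x.
exists (\sum_(z <- s) `|f z|) => [|sigma]; first by apply: sumr_ge0.
by rewrite (big_rem _ (sP sigma)) /= lerDl sumr_ge0.
Qed.

Lemma sum_geometric_le (F : numFieldType) (q : F) (n : nat) :
  0 <= q < 1 -> \sum_(i < n) q ^+ i <= (1 - q)^-1.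
Proof.
case/andP=> q_ge0 q_lt1.
have q1_gt0 : 0 < 1 - q by rewrite subr_gt0.
rewrite -[leRHS]mul1r ler_pdivlMr // mulrC.
by rewrite -opprB mulNr -subrX1 opprB gerBl exprn_ge0.
Qed.

Lemma laurent_sum0_bound (K : fieldExtType rat) (F : numFieldType)
    (sigma : {rmorphism K -> F}) (pi : K) (c : int -> K) (n : nat) (M : F) :
  1 < `|sigma pi| -> 0 <= M ->
  (forall j : int, - n%:Z <= j -> `|sigma (c j)| <= M) ->
  `|sigma (laurent_sum pi c n 0)| <= M * (1 - `|sigma pi|^-1)^-1.
Proof.
move=> pi_large M_ge0 cM.
have pi_gt0 : 0 < `|sigma pi| by apply: lt_trans pi_large.
have q_int : 0 <= `|sigma pi|^-1 < 1.
  by rewrite invr_ge0 normr_ge0 invf_lt1.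
rewrite rmorph_sum; apply: le_trans (ler_norm_sum _ _ _) _.
apply: le_trans (ler_wpM2l M_ge0 (sum_geometric_le (n + 1) q_int)).
(* Reversing the index matches [pi ^ (i - n)] with the power [n - i] of the ratio. *)
rewrite mulr_sumr [leRHS](reindex_inj rev_ord_inj) /=.
apply: ler_sum => i _; rewrite rmorphM normrM.
have def_exp : i%:Z - n%:Z = - (n + 1 - i.+1)%N%:Z.
  by rewrite -subzn // opprB -[i.+1]addn1 !PoszD opprD addrACA subrr addr0.
rewrite [in pi ^ _]def_exp -exprnN fmorphV rmorphXn normfV normrX -exprVn.
apply: ler_wpM2r; first by rewrite exprn_ge0 ?invr_ge0.
by apply: cM; rewrite lerDr.
Qed.

Theorem proposition6p6 (R : realType) (K : fieldExtType rat)
    (Kv : forall v : finite_place R K, completion v)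
    (A : set K) (pi : K) (Reps : set K)
    (A_neq0 : A <> [set 0])
    (pi_int : ring_of_integers K pi)
    (A_gen : A = principal_ideal pi)
    (pi_large : strictly_large R pi)
    (Reps_complete : complete_representatives A Reps)
    (Reps0 : Reps 0) :
  bounded_type (special_type Kv pi Reps).
Proof.
have pi_neq0 : pi != 0.
  apply/eqP => pi0; apply: A_neq0; rewrite A_gen pi0; apply/seteqP; split=> x /=.
    by case=> y _ <-; rewrite mul0r.
  by move=> ->; exists 0;
    [exact: ring_of_integers0 | rewrite mul0r].
rewrite A_gen in Reps_complete.
have /finite_seqP [rs defReps] :=
  complete_representatives_finite pi_int pi_neq0 Reps_complete.
have [M M_ge0 MP] : exists2 M : R[i], 0 <= M &
    forall r, Reps r -> forall sigma : {rmorphism K -> R[i]}, `|sigma r| <= M.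
  have [b b_ge0 bP] : exists2 b : K -> R[i], (forall r, 0 <= b r) &
      forall r (sigma : {rmorphism K -> R[i]}), `|sigma r| <= b r.
    have /choice [b bP] : forall r, exists b : R[i], 0 <= b /\
        forall sigma : {rmorphism K -> R[i]}, `|sigma r| <= b.
      move=> r; have [b b_ge0 bP] := conjugates_bounded (@idfun R[i]) r.
      by exists b.
    by exists b => r; have [] := bP r.
  exists (\sum_(r <- rs) b r) => [|r]; first by apply: sumr_ge0.
  rewrite defReps /= => r_rs sigma; apply: le_trans (bP r sigma) _.
  by rewrite (big_rem _ r_rs) /= lerDl sumr_ge0.
have [D D_ge0 DP] := conjugates_bounded (fun z : R[i] => (1 - `|z|^-1)^-1) pi.
(* The added 1 makes [C] positive and the final inequality strict. *)
pose C := M * D + 1.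
have C_gt0 : 0 < C by rewrite ltr_wpDl ?mulr_ge0.
have defC : C = (complex.Re C)%:C%C by apply/esym/RRe_real/gtr0_real.
exists (complex.Re C) => [|alpha sigma]; first by rewrite -ltcR -defC.
(* The floor is either a truncated expansion or the default value 0, for which positivity of [C]
   suffices. *)
rewrite -defC /= /special_floor; case: xgetP => [x _|_]; last first.
  by rewrite rmorph0 normr0.
case=> n [c [[c_Reps _] ->]].
have large := pi_large sigma.
have /(laurent_sum0_bound large M_ge0)/le_lt_trans -> //:
    forall j : int, - n%:Z <= j -> `|sigma (c j)| <= M.
  by move=> j /c_Reps/MP.
apply: le_lt_trans (_ : M * D < C); last by rewrite /C ltrDl.
apply: ler_wpM2l => //; apply: le_trans (DP sigma).
by apply: real_ler_norm; rewrite realV realB ?realV // normr_real.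
Qed.
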